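(* Let $X$ have the standard Cauchy distribution, with distribution function $F(x)=\frac1\pi\arctan(x)+\frac12$, $x\in\mathbb{R}$, and let $\phi:\mathbb{R}\to\mathbb{R}$ be an arbitrary convex function (not necessarily monotone). Then $\phi(X)\in\mathcal{D}^-$.
   Context: For real random variables, $X \le_{st} Y$ means $P(X\le t)\ge P(Y\le t)$ for all $t\in\mathbb{R}$. A real random variable $X$ (equivalently its distribution function $F_X$) belongs to $\mathcal{D}^-$ if for every $n\in\mathbb{N}$, all $\theta_1,\dots,\theta_n\ge 0$ with $\sum_{i=1}^n\theta_i=1$, and i.i.d. random variables $X_1,\dots,X_n$ with distribution $F_X$, we have $X_1\le_{st}\sum_{i=1}^n\theta_iX_i$. *)

(* Defs.v *)
From HB Require Import structures.
From mathcomp Require Import all_boot all_order all_algebra.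
From mathcomp Require Import all_classical all_reals all_analysis.
Set Implicit Arguments. Unset Strict Implicit. Unset Printing Implicit Defensive.
Import Order.TTheory GRing.Theory Num.Theory.
Local Open Scope classical_set_scope.
Local Open Scope ring_scope.

Definition distfun {d : measure_display} {Omega : measurableType d} {R : realType}
  (P : probability Omega R) (Y : Omega -> R) (t : R) : \bar R :=
  P [set w | Y w <= t].

Definition mutually_independent {d : measure_display} {Omega : measurableType d}
  {R : realType} (n : nat) (P : probability Omega R) (Y : 'I_n -> Omega -> R) :=
  forall B : 'I_n -> set R, (forall i, measurable (B i)) ->
    P (\bigcap_(i in [set: 'I_n]) (Y i @^-1` B i)) =
    (\prod_(i < n) P (Y i @^-1` B i))%E.

(* Y (a random variable on (Omega, P)) belongs to the class D^- :
   for every n >= 1 (indices 'I_n.+1, X_1 being the index ord0), all weights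
   theta_i >= 0 summing to 1, and all i.i.d. random variables X_i (on any
   probability space) with the distribution function of Y, we have
   X_1 <=_st sum_i theta_i X_i, i.e. P(X_1 <= t) >= P(sum theta_i X_i <= t). *)
Definition in_Dminus {d : measure_display} {Omega : measurableType d}
  {R : realType} (P : probability Omega R) (Y : Omega -> R) : Prop :=
  forall (n : nat) (theta : 'I_n.+1 -> R),
    (forall i, 0 <= theta i) -> \sum_(i < n.+1) theta i = 1 ->
    forall (d' : measure_display) (Omega' : measurableType d')
      (Q : probability Omega' R) (Xs : 'I_n.+1 -> Omega' -> R),
      (forall i, measurable_fun setT (Xs i)) ->
      mutually_independent Q Xs ->
      (forall i t, distfun Q (Xs i) t = distfun P Y t) ->
      forall t : R,
        (distfun Q (fun w => (\sum_(i < n.+1) theta i * Xs i w)%R) t <=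
         distfun Q (Xs ord0) t)%E.

(* Main.v *)
(** If [X, X'] are independent standard Cauchy variables and [p + q = 1] with
    [p, q > 0], then [p X + q X'] is again standard Cauchy, so convexity gives
    [P (p phi(X) + q phi(X') <= t) <= P (phi (p X + q X') <= t) = P (phi(X) <= t)].
    Replacing [phi(X)], [phi(X')] by independent variables that stochastically
    dominate [phi(X)] only decreases the left-hand side (condition on one
    variable at a time). Hence the variables dominating [phi(X)] are closed under
    convex combinations of two independent members, and the general case follows
    by induction, replacing the first two variables by their normalised
    combination, which remains independent of the others.

    Stability of the Cauchy law is the convolution identity [f_p * f_q = f_1] for
    the densities of [p X] and [q X']. It comes from an explicit antiderivative
    given by partial fractions; when [p = q] the two denominators coincide at
    [s = 0] and the formula breaks down, so the identity is proved for [s <> 0],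
    which suffices almost everywhere. *)
Require Import Defs.
From HB Require Import structures.
From mathcomp Require Import all_boot all_order all_algebra.
From mathcomp Require Import all_classical all_reals all_analysis.
From mathcomp Require Import measurable_realfun.
From mathcomp Require Import ring lra.
Set Implicit Arguments.
Unset Strict Implicit.
Unset Printing Implicit Defensive.
Import Order.TTheory GRing.Theory Num.Theory.
Import numFieldNormedType.Exports.
Local Open Scope classical_set_scope.
Local Open Scope ring_scope.

(** * Improper integrals over a left half-line and over the whole line *)

Lemma ge0_continuous_FTC2Ny (R : realType) (f F : R -> R) (t l : R) :
  (forall x, 0 <= f x) -> continuous f -> (forall x : R, is_derive x (1 : R) F (f x)) ->
  F (- x) @[x --> +oo] --> l ->
  (\int[lebesgue_measure]_(x in `]-oo, t]) (f x)%:E = (F t - l)%:E)%E.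
Proof.
move=> f0 cf dF Fl.
have cF : continuous F.
  by move=> x; apply/differentiable_continuous/derivable1_diffP; apply: ex_derive.
(* The reflection [y -> - y] maps []-oo, t]] onto [[- t, +oo[], where the half-line theorem applies;
   the integrand becomes [f (- y)], with antiderivative [- F (- y)]. *)
have dFN (x : R) : is_derive x (1 : R) (fun y => - F (- y)) (f (- x)).
  have /is_deriveN := @is_derive1_comp _ F -%R x _ _ (dF (- x)) (is_deriveNid x 1).
  by move/is_derive_eq; apply; rewrite mulrN1 opprK.
have {1}-> : t = - (- t) by rewrite opprK.
rewrite ge0_integration_by_substitutionNy//; last first.
  exact: continuous_subspaceT.
rewrite (@ge0_continuous_FTC2y _ _ (fun y => - F (- y)) _ (- l)).
- by rewrite opprK /= opprK addeC -EFinD.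
- by move=> x _ /=.
- apply: continuous_subspaceT => x; apply: continuous_comp; last exact: cf.
  exact: opp_continuous.
- exact: cvgN.
- by move=> x _.
- apply: cvg_at_right_filter; apply: cvgN.
  by apply: (@continuous_comp _ _ _ -%R F); [exact: opp_continuous|exact: cF].
- by move=> x _; rewrite derive1E derive_val.
Qed.

Lemma ge0_continuous_FTC2T (R : realType) (f F : R -> R) (lN ly : R) :
  (forall x, 0 <= f x) -> continuous f -> (forall x : R, is_derive x (1 : R) F (f x)) ->
  F (- x) @[x --> +oo] --> lN -> F x @[x --> +oo] --> ly ->
  (\int[lebesgue_measure]_x (f x)%:E = (ly - lN)%:E)%E.
Proof.
move=> f0 cf dF FlN Fly.
have cF : continuous F.
  by move=> x; apply/differentiable_continuous/derivable1_diffP; apply: ex_derive.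
have mf : measurable_fun [set: R] (fun x => (f x)%:E).
  by apply/measurable_EFinP; exact: continuous_measurable_fun.
rewrite -(setvU `]-oo, 0%R]) ge0_integral_setU//=; last 4 first.
- exact: measurableC.
- by rewrite setvU.
- by move=> x _; rewrite lee_fin.
- by apply/disj_setPCr.
rewrite addeC setCitvl (@ge0_continuous_FTC2Ny _ f F _ lN)//.
rewrite integral_itv_obnd_cbnd; last exact: measurable_funTS.
rewrite (ge0_continuous_FTC2y _ _ Fly)//=.
- by rewrite -EFinD; congr EFin; ring.
- exact: continuous_subspaceT.
- by apply: cvg_at_right_filter; exact: cF.
- by move=> x _; rewrite derive1E derive_val.
Qed.

(** * The Cauchy density and distribution function, with differentiation rules *)

Definition cauchy_pdf {R : realType} (x : R) : R := (pi * (1 + x ^+ 2))^-1.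
Definition cauchy_cdf {R : realType} (x : R) : R := atan x / pi + 2^-1.

Lemma cauchy_pdf_ge0 (R : realType) (x : R) : 0 <= cauchy_pdf x.
Proof. by rewrite invr_ge0 mulr_ge0 ?pi_ge0// addr_ge0// sqr_ge0. Qed.

Lemma continuous_cauchy_pdf (R : realType) : continuous (@cauchy_pdf R).
Proof.
move=> x; apply: cvgV; last first.
  by apply: cvgM; [exact: cvg_cst|exact: continuous_oneDsqr].
by rewrite mulf_neq0 ?gt_eqF ?pi_gt0 ?ltr_pwDl ?sqr_ge0.
Qed.


Lemma is_derive_addf (R : realType) (f g : R -> R) (x a b : R) :
  is_derive x (1 : R) f a -> is_derive x (1 : R) g b ->
  is_derive x (1 : R) (fun y => f y + g y) (a + b).
Proof. by move=> df dg; have := is_deriveD df dg. Qed.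

Lemma is_derive_subf (R : realType) (f g : R -> R) (x a b : R) :
  is_derive x (1 : R) f a -> is_derive x (1 : R) g b ->
  is_derive x (1 : R) (fun y => f y - g y) (a - b).
Proof. by move=> df dg; have := is_deriveB df dg. Qed.

Lemma is_derive_mulcf (R : realType) (f : R -> R) (c x a : R) :
  is_derive x (1 : R) f a -> is_derive x (1 : R) (fun y => c * f y) (c * a).
Proof. by move=> df; have := is_deriveZ c df. Qed.

Lemma is_derive_sqrf (R : realType) (f : R -> R) (x a : R) :
  is_derive x (1 : R) f a -> is_derive x (1 : R) (fun y => f y ^+ 2) (2 * f x * a).
Proof.
move=> df; have -> : (fun y => f y ^+ 2) = f * f by apply/funext => y; rewrite expr2.
by have /is_derive_eq := is_deriveM df df; apply; rewrite -mulr2n -mulrA mulr_natl.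
Qed.

Lemma is_derive_compf (R : realType) (f g : R -> R) (x a b : R) :
  is_derive x (1 : R) g b -> is_derive (g x) (1 : R) f a ->
  is_derive x (1 : R) (fun y => f (g y)) (a * b).
Proof. by move=> dg df; have := is_derive1_comp df dg. Qed.

Lemma is_derive_affine (R : realType) (a b x : R) :
  is_derive x (1 : R) (fun y => a * y + b) a.
Proof.
have := is_derive_addf (is_derive_mulcf a (is_derive_id x (1 : R))) (is_derive_cst b x (1 : R)).
by move/is_derive_eq; apply; rewrite mulr1 addr0.
Qed.

Lemma is_derive_cauchy_cdf (R : realType) (x : R) :
  is_derive x (1 : R) cauchy_cdf (cauchy_pdf x).
Proof.
have -> : cauchy_cdf = (fun y : R => pi^-1 * atan y + 2^-1).
  by apply/funext => y; rewrite /cauchy_cdf mulrC.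
have := is_derive_addf (is_derive_mulcf pi^-1 (is_derive1_atan x))
  (is_derive_cst (2^-1 : R) x (1 : R)).
by move/is_derive_eq; apply; rewrite addr0 /cauchy_pdf invfM.
Qed.

Lemma cauchy_cdfN (R : realType) (x : R) : cauchy_cdf (- x) = 1 - cauchy_cdf x.
Proof.
rewrite /cauchy_cdf atanN; have : (pi : R) != 0 by rewrite gt_eqF ?pi_gt0.
by move: (pi : R) => c c0; field.
Qed.

Lemma cvgy_cauchy_cdf (R : realType) : @cauchy_cdf R x @[x --> +oo] --> (1 : R).
Proof.
have -> : 1 = pi / 2 / pi + 2^-1 :> R.
  have : (pi : R) != 0 by rewrite gt_eqF ?pi_gt0.
  by move: (pi : R) => c c0; field.
apply: (@cvgD _ _ _ _ _ (fun x : R => atan x / pi) (fun=> 2^-1) (pi / 2 / pi)); last exact: cvg_cst.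
apply: (@cvgMr_tmp _ _ _ _ (@atan R)); exact: cvgy_atan.
Qed.

Lemma cvgy_affine (R : realType) (a b : R) : 0 < a -> a * x + b @[x --> +oo] --> +oo.
Proof.
move=> a0; apply/cvgryPge => A; near=> x.
rewrite -lerBlDr -ler_pdivrMl//.
Unshelve. all: end_near. Qed.

Lemma integral_cauchy_pdf_affine (R : realType) (a b : R) (t : R) : 0 < a ->
  (\int[lebesgue_measure]_(s in `]-oo, t]) (a * cauchy_pdf (a * s + b))%:E =
    (cauchy_cdf (a * t + b))%:E)%E.
Proof.
move=> a0.
have dF x : is_derive x (1 : R) (fun s => cauchy_cdf (a * s + b)) (a * cauchy_pdf (a * x + b)).
  have := is_derive_compf (is_derive_affine a b x) (is_derive_cauchy_cdf _).
  by move/is_derive_eq; apply; rewrite mulrC.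
rewrite (ge0_continuous_FTC2Ny _ _ _ dF (l := 0)).
- by rewrite subr0.
- by move=> x; rewrite mulr_ge0 ?cauchy_pdf_ge0 ?ltW.
- move=> x; apply: cvgMl_tmp; apply: (@continuous_comp _ _ _ (fun x => a * x + b) cauchy_pdf);
    last exact: continuous_cauchy_pdf.
  by apply: cvgD; [apply: cvgMl_tmp; exact: cvg_id|exact: cvg_cst].
(* The limit at [-oo] is read off the one at [+oo] through the symmetry of the Cauchy law. *)
- have -> : (fun x => cauchy_cdf (a * - x + b)) = (fun x => 1 - cauchy_cdf (a * x - b)).
    by apply/funext => x; rewrite -cauchy_cdfN; congr cauchy_cdf; ring.
  rewrite -(subrr (1 : R)); apply: cvgB; first exact: cvg_cst.
  by apply: (cvg_comp _ _ (@cvgy_affine _ a (- b) a0)); exact: cvgy_cauchy_cdf.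
Qed.

(** * Convolution of two scaled Cauchy densities *)

Section convolution.
Variables (R : realType) (p q s : R).
Hypotheses (p0 : 0 < p) (q0 : 0 < q).

(* Partial fraction coefficients of [1 / ((1 + x^2) (q^2 + (p x - s)^2))]. *)
Let N := (s ^+ 2 + (p + q) ^+ 2) * (s ^+ 2 + (q - p) ^+ 2).
Let c := q / pi ^+ 2.
Let al := 2 * p * s / N.
Let be := (s ^+ 2 + q ^+ 2 - p ^+ 2) / N.
Let de := p ^+ 2 * (s ^+ 2 + p ^+ 2 - q ^+ 2) / N.

(** Termwise antiderivative of [(al x + be) / (1 + x^2) + (de - al p (p x - s)) / (q^2 + (p x -
    s)^2)], scaled by [c]: the linear numerators give the logarithms, the constant ones the
    arctangents. *)
Definition cauchy_conv_prim x := c * (al / 2 * (ln (1 + x ^+ 2) - ln (q ^+ 2 + (p * x - s) ^+ 2))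
   + be * atan x + de / (p * q) * atan (p / q * x - s / q)).

(** The integrand of [f_p * f_q] at [s], parametrised by the value [x] of [X] rather than of [p X],
    so that only the second factor, the density of [q X'] at [s - p x], is rescaled. *)
Definition cauchy_conv_fun x := cauchy_pdf x * (q^-1 * cauchy_pdf (q^-1 * (s - p * x))).

Lemma is_derive_cauchy_conv_prim x : s != 0 -> is_derive x (1 : R)
  cauchy_conv_prim (cauchy_conv_fun x).
Proof.
move=> s0.
have A0 y : 0 < 1 + y ^+ 2 :> R by rewrite ltr_pwDl ?sqr_ge0.
have B0 y : 0 < q ^+ 2 + y ^+ 2 :> R by rewrite ltr_pwDl ?sqr_ge0 ?exprn_gt0.
have d1 : is_derive x (1 : R) (fun y => 1 + y ^+ 2) (2 * x).
  have := is_derive_addf (is_derive_cst (1:R) x (1 : R)) (is_derive_sqrf (is_derive_id x (1 : R))).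
  by move/is_derive_eq; apply; rewrite add0r mulr1.
have d2 : is_derive x (1 : R) (fun y => q ^+ 2 + (p * y - s) ^+ 2) (2 * (p * x - s) * p).
  have := is_derive_addf (is_derive_cst (q ^+ 2) x (1 : R))
    (is_derive_sqrf (is_derive_affine p (- s) x)).
  by move/is_derive_eq; apply; rewrite add0r.
have := is_derive_mulcf c (is_derive_addf (is_derive_addf
  (is_derive_mulcf (al / 2)
    (is_derive_subf (is_derive_compf d1 (is_derive1_ln (A0 _)))
      (is_derive_compf d2 (is_derive1_ln (B0 _)))))
  (is_derive_mulcf be (is_derive1_atan x)))
  (is_derive_mulcf (de / (p * q))
    (is_derive_compf (is_derive_affine (p / q) (- (s / q)) x) (is_derive1_atan _)))).
move/is_derive_eq; apply.
(* Here [s <> 0] enters: the factor [s^2 + (q - p)^2] vanishes when [s = 0] and [p = q]. *)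
have N0 : N != 0 by rewrite mulf_neq0 // gt_eqF // ltr_pwDl ?sqr_ge0// exprn_even_gt0.
have := A0 x. have := B0 (p * x - s). have pi0 : (pi : R) != 0 by rewrite gt_eqF ?pi_gt0.
rewrite /cauchy_conv_fun /cauchy_pdf /al /be /de /c.
move: N0; rewrite /N. move: (pi : R) pi0 => pi' pi0.
move=> N0 B A.
field.
move: N0; rewrite mulf_eq0 negb_or => /andP[-> ->].
have -> : s - p * x = - (p * x - s) by rewrite opprB.
by rewrite sqrrN pi0 (gt_eqF A) (gt_eqF B) (gt_eqF p0) (gt_eqF q0).
Qed.

Lemma cvgy_cauchy_conv_prim :
  cauchy_conv_prim x @[x --> +oo] -->
  c * (al / 2 * - ln (p ^+ 2) + be * (pi / 2) + de / (p * q) * (pi / 2)).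
Proof.
apply: cvgMl_tmp; apply: cvgD; last first.
  apply: cvgMl_tmp.
  apply: (cvg_comp _ _ (@cvgy_affine _ (p / q) (- (s / q)) (divr_gt0 p0 q0))).
  exact: cvgy_atan.
apply: cvgD; apply: cvgMl_tmp; last exact: cvgy_atan.
(* The quotient of the two quadratics inside the logarithms, written in [z = 1 / x]: its limit at
   infinity becomes continuity at 0, where it equals [1 / p^2]. *)
pose g (z : R) : R := (z ^+ 2 + 1) / (q ^+ 2 * z ^+ 2 + (p - s * z) ^+ 2).
have -> : - ln (p ^+ 2) = ln (g 0).
  rewrite /g mulr0 subr0 !expr0n/= mulr0 !add0r div1r lnV ?posrE ?exprn_gt0//.
have g0 : 0 < g 0.
  by rewrite /g mulr0 subr0 !expr0n/= mulr0 !add0r div1r invr_gt0 exprn_gt0.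
have cg : {for 0, continuous g}.
  apply: cvgM.
    by apply: cvgD; [exact: exprn_continuous|exact: cvg_cst].
  apply: cvgV.
    by rewrite mulr0 subr0 expr0n/= mulr0 add0r gt_eqF ?exprn_gt0.
  apply: cvgD; first by apply: cvgMl_tmp; exact: exprn_continuous.
  apply: (@continuous_comp _ _ _ (fun z => p - s * z) (fun z => z ^+ 2));
    last exact: exprn_continuous.
  by apply: cvgB; [exact: cvg_cst|apply: cvgMl_tmp; exact: cvg_id].
have iy : (x : R)^-1 @[x --> +oo] --> 0.
  apply/gtr0_cvgV0; last exact: cvg_id.
  by near=> x; near: x; exact: nbhs_pinfty_gt.
have : ln (g x^-1) @[x --> +oo] --> ln (g 0).
  apply: (@cvg_comp _ _ _ (fun x : R => x^-1) (fun z => ln (g z)) _ _ _ iy).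
  by apply: (@continuous_comp _ _ _ g (@ln R)) => //; exact: continuous_ln.
apply: cvg_trans; apply: near_eq_cvg; near=> x.
have x0 : 0 < x by near: x; exact: nbhs_pinfty_gt.
rewrite /= -ln_div ?posrE; last 2 first.
  by rewrite ltr_pwDl ?sqr_ge0.
  by rewrite ltr_pwDl ?sqr_ge0 ?exprn_gt0.
congr ln; rewrite /g.
have B0 : q ^+ 2 + (p * x - s) ^+ 2 != 0.
  by rewrite gt_eqF// ltr_pwDl ?sqr_ge0 ?exprn_gt0.
by field; rewrite B0 gt_eqF.
Unshelve. all: end_near. Qed.

End convolution.

(** [al] is odd in [s] while [be] and [de] are even. This turns the limit at [+oo] for [- s] into
    the limit at [-oo] for [s]. *)
Lemma cauchy_conv_primN (R : realType) (p q s x : R) :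
  cauchy_conv_prim p q s (- x) = - cauchy_conv_prim p q (- s) x.
Proof.
rewrite /cauchy_conv_prim !sqrrN atanN.
rewrite (_ : p * - x - s = - (p * x - - s)); last by ring.
rewrite (_ : p / q * - x - s / q = - (p / q * x - - s / q)); last by ring.
rewrite sqrrN atanN; ring.
Qed.

Lemma integral_cauchy_conv (R : realType) (p q s : R) : 0 < p -> 0 < q -> p + q = 1 -> s != 0 ->
  (\int[lebesgue_measure]_x (cauchy_conv_fun p q s x)%:E = (cauchy_pdf s)%:E)%E.
Proof.
move=> p0 q0 pq s0.
have dG (x : R) := is_derive_cauchy_conv_prim p0 q0 x s0.
have Gy := @cvgy_cauchy_conv_prim R p q s p0 q0.
have GN := cvgN (@cvgy_cauchy_conv_prim R p q (- s) p0 q0).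
have E : - cauchy_conv_prim p q (- s) = (fun x => cauchy_conv_prim p q s (- x)).
  by apply/funext => x; rewrite cauchy_conv_primN.
rewrite E in GN.
rewrite (ge0_continuous_FTC2T _ _ dG (GN _) Gy).
(* The logarithmic terms at the two ends are equal and cancel, so the value of [ln] may be
   generalised. What remains is [c * pi * (be + de / (p * q))], and [p + q = 1] turns the first
   factor of [N] into [s^2 + 1]. *)
- congr EFin; rewrite /cauchy_pdf sqrrN; move: (ln _) => L.
  have pi0 : (pi : R) != 0 by rewrite gt_eqF ?pi_gt0.
  have N1 : s ^+ 2 + (q - p) ^+ 2 != 0.
    by rewrite gt_eqF// ltr_pwDl ?sqr_ge0// exprn_even_gt0.
  have N2 : 1 + s ^+ 2 != 0 by rewrite gt_eqF// ltr_pwDl ?sqr_ge0.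
  have qE : q = 1 - p by rewrite -pq; ring.
  rewrite pq; move: N1 p0 q0; rewrite qE => N1 p1 q1.
  move: (pi : R) pi0 => c c0; field.
  by rewrite c0 N1 N2 (gt_eqF p1) (gt_eqF q1).
- by move=> x; rewrite /cauchy_conv_fun !mulr_ge0 ?cauchy_pdf_ge0// invr_ge0 ltW.
- move=> x; apply: (@cvgM _ _ _ _ cauchy_pdf); first exact: continuous_cauchy_pdf.
  apply: cvgMl_tmp.
  apply: (@continuous_comp _ _ _ (fun x => q^-1 * (s - p * x)) cauchy_pdf);
    last exact: continuous_cauchy_pdf.
  by apply: cvgMl_tmp; apply: cvgB; [exact: cvg_cst|apply: cvgMl_tmp; exact: cvg_id].
Qed.

(** * Stability of the Cauchy law *)

Lemma probability_eq_cdf (R : realType) (m1 m2 : probability (measurableTypeR R) R) :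
  (forall x : R, m1 [set y : R | y <= x] = m2 [set y : R | y <= x]) ->
  forall A, measurable A -> m1 A = m2 A.
Proof.
move=> m12 A mA.
have m12c x : m1 `]x, +oo[%classic = m2 `]x, +oo[%classic.
  rewrite -setCitvl !probability_setC; [|exact: measurable_itv..].
  by rewrite set_itvNyc m12.
(* The open right rays form a pi-system generating the Borel sets, and the rays starting at [- n]
   exhaust the line. *)
apply: (@measure_unique _ R (measurableTypeR R) (@RGenOInfty.G R)
  (fun n => `]- n%:R, +oo[%classic)) => //.
- exact: RGenOInfty.measurableE.
- move=> _ _ [x ->] [y ->]; exists (Num.max x y); apply/seteqP; split => z /=;
    rewrite !in_itv/= !andbT gt_max.
    by move=> [-> ->].
  by move/andP.
- by move=> n; exists (- n%:R).
- rewrite -subTset => x _; exists (Num.truncn `|x|).+1 => //=.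
  rewrite in_itv/= andbT ltrNl (le_lt_trans (ler_norm _))// normrN.
  by rewrite truncnS_gt.
- by move=> _ [x ->]; exact: m12c.
- by move=> n; rewrite (le_lt_trans (probability_le1 _ _))// ltry.
Qed.

Section stable.
Variables (R : realType) (mu : probability (measurableTypeR R) R).
Hypothesis mu_cdf : forall x : R, mu [set y : R | y <= x] = (cauchy_cdf x)%:E.

Let cdf_le (a : R) (b t : R) : 0 < a ->
  mu [set y : R | a * y + b <= t] = (cauchy_cdf (a^-1 * t + - (a^-1 * b)))%:E.
Proof.
move=> a0; rewrite -mu_cdf; congr (mu _); apply/seteqP; split => y /=.
  by move=> h; rewrite -mulrBr ler_pdivlMl// lerBrDr.
by move=> h; rewrite -lerBrDr -ler_pdivlMl// mulrBr.
Qed.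

Let measurable_le (p q t : R) :
  measurable [set z : R * R | p * z.1 + q * z.2 <= t].
Proof.
rewrite -[X in measurable X]setTI.
apply: (@measurable_fun_le _ _ _ setT (fun z : R * R => p * z.1 + q * z.2) (cst t)) => //.
by apply: measurable_funD; apply: measurable_funM.
Qed.

(** Putting the half-line into an indicator makes the integral range over the whole line, as the
    Tonelli exchanges below require. *)
Lemma integral_cauchy_pdf_indic (a b t : R) : 0 < a ->
  (\int[lebesgue_measure]_s ((a * cauchy_pdf (a * s + b)) * \1_[set s : R | (s <= t)%R] s)%:E =
  (cauchy_cdf (a * t + b))%:E)%E.
Proof.
move=> a0; rewrite -integral_cauchy_pdf_affine// [RHS]integral_mkcond epatch_indic.
by apply: eq_integral => s _; rewrite -EFinM; congr ((_ * \1_ _ _)%:E).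
Qed.

(** Two Tonelli exchanges: the first brings the density of [X] outside, the second brings out the
    value [s] of the sum, leaving the integral over [s <= t] of the convolution, which is almost
    everywhere the Cauchy density. *)
Lemma cauchy_stable_cdf (p q t : R) : 0 < p -> 0 < q -> p + q = 1 ->
  (\int[mu]_y mu [set x | (p * x + q * y <= t)%R] = (cauchy_cdf t)%:E)%E.
Proof.
move=> p0 q0 pq.
pose A := [set z : R * R | p * z.2 + q * z.1 <= t].
have mA : measurable A.
  have := measurable_le q p t.
  by congr (measurable _); apply/seteqP; split => z /=; rewrite addrC.
transitivity (\int[mu]_y \int[lebesgue_measure]_x (cauchy_pdf x * \1_A (y, x))%:E)%E.
  apply: eq_integral => y _; rewrite (cdf_le _ _ p0).
  set b := _ + _.
  rewrite -[b]mul1r -[1 * b]addr0 -integral_cauchy_pdf_indic//.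
  apply: eq_integral => x _; rewrite !mul1r addr0; congr ((_ * _)%:E).
  rewrite !indicE; congr ((_ : bool)%:R); apply/idP/idP; rewrite !inE /A /b /=.
    by rewrite -mulrBr ler_pdivlMl// lerBrDr.
  by rewrite -mulrBr ler_pdivlMl// lerBrDr.
have mpdf : measurable_fun [set: R] (@cauchy_pdf R).
  by apply: continuous_measurable_fun; exact: continuous_cauchy_pdf.
rewrite (@fubini_tonelli _ _ _ _ _ mu (@lebesgue_measure R)
  (fun z => (cauchy_pdf z.2 * \1_A z)%:E)); last 2 first.
  apply/measurable_EFinP; apply: measurable_funM => //.
  exact: measurableT_comp.
  by move=> z; rewrite lee_fin mulr_ge0 ?cauchy_pdf_ge0.
pose D := [set s : R | s <= t].
have mD : measurable D by rewrite /D -set_itvNyc; exact: measurable_itv.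
have mD1 : measurable_fun setT (\1_D : R -> R) by exact: measurable_indic.
have mk x : measurable_fun [set: R] (fun s => q^-1 * cauchy_pdf (q^-1 * (s - p * x))).
  apply: measurable_funM => //; apply: measurableT_comp => //.
  by apply: measurable_funM => //; apply: measurable_funB.
(* For fixed [x], the probability of [q y + p x <= t] is the integral over [s <= t] of the density
   of [q X' + p x]. *)
transitivity (\int[lebesgue_measure]_x \int[lebesgue_measure]_s
    (cauchy_conv_fun p q s x * \1_D s)%:E)%E.
  apply: eq_integral => x _ /=.
  under eq_integral do rewrite EFinM.
  rewrite ge0_integralZl//; last 2 first.
  - apply/measurable_EFinP; apply: (measurableT_comp (f := (\1_A : R * R -> R))).
      exact: measurable_indic.
    exact: measurable_fun_pair.
  - by rewrite lee_fin cauchy_pdf_ge0.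
  under [RHS]eq_integral do rewrite /cauchy_conv_fun -mulrA EFinM.
  rewrite ge0_integralZl//; last 3 first.
  - apply/measurable_EFinP; apply: measurable_funM; [exact: mk|exact: mD1].
  - move=> s _; rewrite lee_fin mulr_ge0 ?indicE ?ler0n//.
    by rewrite mulr_ge0 ?cauchy_pdf_ge0 ?invr_ge0 ?ltW.
  - by rewrite lee_fin cauchy_pdf_ge0.
  congr *%E.
  have qV : 0 < q^-1 by rewrite invr_gt0.
  transitivity (mu [set y : R | q * y + p * x <= t]).
    pose E := [set y : R | q * y + p * x <= t].
    have mE : measurable E.
      rewrite -[X in measurable X]setTI.
      apply: (@measurable_fun_le _ _ _ setT (fun y : R => q * y + p * x) (cst t)) => //.
      by apply: measurable_funD => //; apply: measurable_funM.
    transitivity (\int[mu]_y (\1_E y)%:E)%E; last by rewrite integral_indic// setIT.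
    apply: eq_integral => y _; rewrite !indicE; congr ((_ : bool)%:R%:E).
    by apply/idP/idP; rewrite !inE /A /E /= addrC.
  rewrite cdf_le// -integral_cauchy_pdf_indic//; apply: eq_integral => s _.
  by rewrite -mulrBr.
pose K (z : R * R) := (cauchy_conv_fun p q z.2 z.1 * \1_D z.2)%:E.
have K0 z : (0 <= K z)%E.
  rewrite lee_fin mulr_ge0 ?indicE ?ler0n// /cauchy_conv_fun.
  by rewrite !mulr_ge0 ?cauchy_pdf_ge0 ?invr_ge0 ?ltW.
have mK : measurable_fun setT K.
  apply/measurable_EFinP; apply: measurable_funM; last exact: measurableT_comp.
  rewrite /cauchy_conv_fun; apply: measurable_funM; first exact: measurableT_comp.
  apply: measurable_funM => //; apply: measurableT_comp => //.
  by apply: measurable_funM => //; apply: measurable_funB => //; apply: measurable_funM.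
rewrite (fubini_tonelli (m1 := @lebesgue_measure R) (m2 := @lebesgue_measure R) K)//.
rewrite -[t]mul1r -[1 * t]addr0 -integral_cauchy_pdf_indic//.
apply: ae_eq_integral => //.
- exact: (measurable_fun_fubini_tonelli_G (m1 := @lebesgue_measure R) K).
- apply/measurable_EFinP; apply: measurable_funM => //.
  apply: measurable_funM => //; apply: measurableT_comp => //.
  by apply: measurable_funD => //; apply: measurable_funM.
(* The convolution identity is known for [s <> 0], and a single point is Lebesgue-null. *)
- exists [set 0]; split => //; first exact: lebesgue_measure_set1.
  move=> s /=; apply: contra_notP => /eqP s0 _ /=.
  rewrite mul1r mul1r addr0 mulrC EFinM -(integral_cauchy_conv p0 q0 pq s0) -ge0_integralZl//.
  + by apply: eq_integral => x _; rewrite -EFinM mulrC.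
  + apply/measurable_EFinP; apply: measurable_funM => //.
    apply: measurable_funM => //; apply: measurableT_comp => //.
    by apply: measurable_funM => //; apply: measurable_funB => //; apply: measurable_funM.
  + move=> x _; rewrite lee_fin /cauchy_conv_fun.
    by rewrite !mulr_ge0 ?cauchy_pdf_ge0 ?invr_ge0 ?ltW.
Qed.

(** The left-hand side is the law of [p X + q X'], so equality of distribution functions extends to
    Borel sets. This generality is used for the sublevel sets of [phi], which need not be
    half-lines. *)
Lemma cauchy_stable (p q : R) (I : set R) : 0 < p -> 0 < q -> p + q = 1 ->
  measurable I ->
  (\int[mu]_y mu [set x | I (p * x + q * y)%R] = mu I)%E.
Proof.
move=> p0 q0 pq mI.
pose M := measurableTypeR R.
(* The coordinates are swapped because the product measure integrates the first one outermost, which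
   is [y] in the statement. *)
pose f (z : M * M) : M := p * z.2 + q * z.1.
have mf : measurable_fun [set: M * M] f.
  have : measurable_fun [set: R * R] (fun z => p * z.2 + q * z.1).
    by apply: measurable_funD; apply: measurable_funM.
  exact.
pose F : {mfun (M * M)%type >-> M} := HB.pack f (isMeasurableFun.Build _ _ _ _ f mf).
pose nu := distribution (mu \x mu)%E F.
have nuE A : nu A = (\int[mu]_y mu [set x | A (p * x + q * y)%R])%E.
  rewrite /nu /distribution /pushforward /product_measure1.
  apply: eq_integral => y _ /=; congr (mu _); apply/seteqP; split => x /=.
  by rewrite /xsection/= inE.
  by rewrite /xsection/= inE.
rewrite -nuE; apply: (@probability_eq_cdf _ nu mu) => // t.
transitivity (nu [set y : R | y <= t]) => //.
by rewrite nuE mu_cdf -(cauchy_stable_cdf t p0 q0 pq).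
Qed.
End stable.

(** * Convex functions and their measurability *)

Lemma convex_function_onem (R : realType) (phi : R -> R) :
  convex_function (setT : set (convex_lmodType R^o))
    (phi : convex_lmodType R^o -> R^o) ->
  forall p q x y : R, 0 <= p -> 0 <= q -> p + q = 1 ->
  phi (p * x + q * y) <= p * phi x + q * phi y.
Proof.
move=> cvx p q x y p0 q0 pq.
have p1 : p <= 1 by rewrite -pq lerDl.
have := cvx (Itv01 p0 p1) x y (mem_setT _) (mem_setT _).
have -> : q = 1 - p by rewrite -pq; ring.
by rewrite !convRE.
Qed.

Lemma convex_sublevel_is_interval (R : realType) (phi : R -> R) (t : R) :
  convex_function (setT : set (convex_lmodType R^o))
    (phi : convex_lmodType R^o -> R^o) ->
  is_interval [set x : R | phi x < t].
Proof.
move=> /convex_function_onem cvx x y /= xt yt z /andP[xz zy].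
have [xy|xy] := eqVneq x y.
  by have -> : z = x by apply/eqP; rewrite eq_le xz xy zy.
have yx0 : 0 < y - x by rewrite subr_gt0 lt_neqAle xy (le_trans xz zy).
have zE : z = (y - z) / (y - x) * x + (z - x) / (y - x) * y.
  by field; rewrite gt_eqF.
have pq : (y - z) / (y - x) + (z - x) / (y - x) = 1 by field; rewrite gt_eqF.
have p0 : 0 <= (y - z) / (y - x) by rewrite divr_ge0 ?(ltW yx0)// subr_ge0.
have q0 : 0 <= (z - x) / (y - x) by rewrite divr_ge0 ?(ltW yx0)// subr_ge0.
have := cvx _ _ x y p0 q0 pq; rewrite -zE => /le_lt_trans; apply.
move: (_ / _) (_ / _) pq p0 q0 => p q pq p0 q0.
have mt : Num.max (phi x) (phi y) < t by rewrite gt_max xt yt.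
rewrite (le_lt_trans _ mt)// -[leRHS]mul1r -pq mulrDl.
by rewrite lerD// ler_wpM2l// le_max lexx ?orbT.
Qed.

(** Strict sublevel sets are intervals, hence Borel, and the open left rays generate the Borel
    sets. *)
Lemma measurable_convex_function (R : realType) (phi : R -> R) :
  convex_function (setT : set (convex_lmodType R^o))
    (phi : convex_lmodType R^o -> R^o) ->
  measurable_fun [set: R] phi.
Proof.
move=> cvx; apply: (measurability (@RGenInftyO.G R)).
  exact: RGenInftyO.measurableE.
move=> _ [_ [t ->] <-]; rewrite setTI.
apply: is_interval_measurable.
rewrite (_ : _ @^-1` _ = [set x | phi x < t]).
  exact: convex_sublevel_is_interval.
by apply/seteqP; split => x /=; rewrite in_itv.
Qed.

(** * Two independent variables dominating [phi(X)] *)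

Section two_variables.
Variables (R : realType).
Local Notation M := (measurableTypeR R).
Variables (mu m1 m2 : probability M R) (phi : R -> R).
Hypothesis mu_cdf : forall x : R, mu [set y : R | y <= x] = (cauchy_cdf x)%:E.
Hypothesis cvx : convex_function (setT : set (convex_lmodType R^o))
    (phi : convex_lmodType R^o -> R^o).
Hypothesis dom1 : forall t : R,
  (m1 [set y : R | (y <= t)%R] <= mu [set x : R | (phi x <= t)%R])%E.
Hypothesis dom2 : forall t : R,
  (m2 [set y : R | (y <= t)%R] <= mu [set x : R | (phi x <= t)%R])%E.

Lemma convex_combination_dominated (p q t : R) : 0 < p -> 0 < q -> p + q = 1 ->
  ((m1 \x m2) [set z : R * R | (p * z.1 + q * z.2 <= t)%R] <=
   mu [set x : R | (phi x <= t)%R])%E.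
Proof.
move=> p0 q0 pq.
have mphi := measurable_convex_function cvx.
have mle (f : M * M -> R) : measurable_fun [set: R * R] f ->
    measurable [set z : M * M | f z <= t].
  move=> mf; rewrite -[X in measurable X]setTI.
  by apply: (@measurable_fun_le _ _ _ setT f (cst t)).
(* The successive events: the original one, the one with the second variable replaced by [phi(X')],
   and the one reached after replacing the first variable and using convexity. *)
pose A1 := [set z : M * M | p * z.1 + q * z.2 <= t].
pose A2 := [set z : M * M | p * z.1 + q * phi z.2 <= t].
pose A4 := [set z : M * M | phi (p * z.1 + q * z.2) <= t].
have mA1 : measurable A1.
  by apply: mle; apply: measurable_funD; apply: measurable_funM.
have mA2 : measurable A2.
  apply: mle; apply: measurable_funD; apply: measurable_funM => //.
  exact: measurableT_comp.
have mA4 : measurable A4.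
  apply: mle; apply: measurableT_comp => //.
  by apply: measurable_funD; apply: measurable_funM.
have mI : measurable [set x : R | phi x <= t].
  rewrite -[X in measurable X]setTI.
  by apply: (@measurable_fun_le _ _ _ setT phi (cst t)).
have sol (a b x y : R) : 0 < b -> (a * x + b * y <= t) = (y <= b^-1 * (t - a * x)).
  by move=> b0; rewrite ler_pdivlMl// lerBrDl.
have solC (a b x y : R) : 0 < b -> (b * y + a * x <= t) = (y <= b^-1 * (t - a * x)).
  by move=> b0; rewrite addrC sol.
(* With the first coordinate fixed at [u], the sections are governed by the level [(t - p u) / q],
   where [dom2] applies. *)
apply: (@le_trans _ _ ((m1 \x mu)%E A2)).
  apply: ge0_le_integral => //; [exact: measurable_fun_xsection..|].
  move=> u _ /=.
  rewrite (_ : xsection A1 u = [set y : R | y <= q^-1 * (t - p * u)]); last first.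
    by apply/seteqP; split => y; rewrite /xsection /= inE /A1 /= sol.
  rewrite (_ : xsection A2 u = [set y : R | phi y <= q^-1 * (t - p * u)])//.
  by apply/seteqP; split => y; rewrite /xsection /= inE /A2 /= sol.
(* The order of integration is reversed, so that the second coordinate can be fixed and [m1]
   replaced through [dom1]; stability then rewrites the target as an integral over the same
   coordinate. *)
rewrite (product_measure_unique (m1 := m1) (m2 := mu) (m' := (m1 \x^ mu)%E)); last 2 first.
  by move=> A B mA mB; exact: product_measure2E.
  exact: mA2.
rewrite -(cauchy_stable mu_cdf p0 q0 pq mI).
apply: ge0_le_integral => //; first exact: (measurable_fun_ysection m1 mA2).
  rewrite (_ : (fun x => _) = mu \o ysection A4); first exact: (measurable_fun_ysection mu mA4).
  apply/funext => v /=; congr (mu _).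
  by apply/seteqP; split => y; rewrite /ysection /= inE.
move=> v _ /=.
apply: (@le_trans _ _ (mu [set x : R | phi x <= p^-1 * (t - q * phi v)])).
  rewrite (_ : ysection A2 v = [set y : R | y <= p^-1 * (t - q * phi v)])//.
  by apply/seteqP; split => y; rewrite /ysection /= inE /A2 /= solC.
have mcomp (f : R -> R) c : measurable_fun [set: R] f ->
    measurable [set x : M | f x <= c].
  move=> mf; rewrite -[X in measurable X]setTI.
  by apply: (@measurable_fun_le _ _ _ setT f (cst c)).
apply: le_measure.
- by rewrite inE; exact: mcomp.
- rewrite inE; apply: (mcomp (fun x => phi (p * x + q * v))).
  apply: measurableT_comp => //.
  by apply: measurable_funD => //; apply: measurable_funM.
- move=> x /=; rewrite -solC// => /(le_trans _); apply.
  by apply: (convex_function_onem cvx) => //; exact: ltW.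
Qed.
End two_variables.

(** * Joint laws and independence after merging two variables *)

Section joint_law.
Context d (T : measurableType d) (R : realType) (Q : probability T R).
Local Notation M := (measurableTypeR R).
Variables (U V : {mfun T >-> M}) (E : set T).
Hypothesis mE : measurable E.
Hypothesis indep : forall C D : set R, measurable C -> measurable D ->
  (Q (U @^-1` C `&` (V @^-1` D `&` E)) = Q (U @^-1` C) * (Q (V @^-1` D) * Q E))%E.

(** Restricting [Q] to [E], normalising by [Q E] and pushing forward by [(U, V)] gives a measure
    that agrees with the product law on rectangles, hence everywhere. If [Q E = 0], both sides
    vanish. *)
Lemma joint_lawI (A : set (M * M)) : measurable A ->
  (Q ((fun w => (U w, V w)) @^-1` A `&` E) =
   (distribution Q U \x distribution Q V) A * Q E)%E.
Proof.
move=> mA.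
pose W w : M * M := (U w, V w).
have mW : measurable_fun setT W by exact: measurable_fun_pair.
have QE : Q E \is a fin_num by exact: fin_num_measure.
have [QE0|QE0] := eqVneq (Q E) 0%E.
  rewrite QE0 mule0; apply/eqP; rewrite eq_le measure_ge0 andbT -QE0.
  apply: le_measure; rewrite ?inE//.
  by apply: measurableI => //; rewrite -[X in measurable X]setTI; apply: (mW measurableT).
have k0 : 0 <= (fine (Q E))^-1 by rewrite invr_ge0 fine_ge0.
pose m' := mscale (NngNum k0)
  (measure_function_pushforward__canonical__measure_function_Measure (mrestr Q mE) mW).
rewrite (product_measure_unique (m' := m'))//.
- transitivity (((fine (Q E))^-1)%:E * Q (W @^-1` A `&` E) * Q E)%E => //.
  by rewrite muleAC -{2}(fineK QE) -EFinM mulVf ?mul1e// fine_eq0.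
- move=> C D mC mD.
  transitivity (((fine (Q E))^-1)%:E * Q (U @^-1` C `&` (V @^-1` D `&` E)))%E.
    by rewrite setIA.
  rewrite indep// muleA muleCA -{2}(fineK QE).
  by rewrite muleAC -EFinM mulVf ?fine_eq0// mul1e muleC.
Qed.
End joint_law.

Lemma bigcap_ord_recl T (n : nat) (F : 'I_n.+1 -> set T) :
  \bigcap_(i in [set: 'I_n.+1]) F i =
  F ord0 `&` \bigcap_(i in [set: 'I_n]) F (lift ord0 i).
Proof.
apply/seteqP; split => [x Fx|x [F0 Fx] i _].
  by split => [|i _]; exact: Fx.
by case: (unliftP ord0 i) => [j|] ->//; exact: Fx.
Qed.

Definition cons_fam (n : nat) (A : Type) (a : A) (f : 'I_n -> A) (i : 'I_n.+1) : A :=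
  if unlift ord0 i is Some j then f j else a.

Lemma cons_fam0 (n : nat) (A : Type) (a : A) (f : 'I_n -> A) : cons_fam a f ord0 = a.
Proof. by rewrite /cons_fam unlift_none. Qed.

Lemma cons_famS (n : nat) (A : Type) (a : A) (f : 'I_n -> A) i :
  cons_fam a f (lift ord0 i) = f i.
Proof. by rewrite /cons_fam liftK. Qed.

Section merge.
Context d (T : measurableType d) (R : realType) (Q : probability T R).
Variables (n : nat) (Xs : 'I_n.+2 -> T -> R).
Hypothesis mXs : forall i, measurable_fun setT (Xs i).
Hypothesis iXs : mutually_independent Q Xs.
Let i1 : 'I_n.+2 := lift ord0 ord0.
Let Xt (i : 'I_n) := Xs (lift ord0 (lift ord0 i)).

Let mpre i (C : set R) : measurable C -> measurable (Xs i @^-1` C).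
Proof. by move=> mC; rewrite -[X in measurable X]setTI; exact: mXs. Qed.

Let tail_event (B : 'I_n -> set R) := \bigcap_(i in [set: 'I_n]) (Xt i @^-1` B i).

Let mtail B : (forall i, measurable (B i)) -> measurable (tail_event B).
Proof.
move=> mB; apply: fin_bigcap_measurable; first exact: finite_finset.
by move=> i _; exact: mpre.
Qed.

Let indep3 (C D : set R) (B : 'I_n -> set R) : measurable C -> measurable D ->
  (forall i, measurable (B i)) ->
  (Q (Xs ord0 @^-1` C `&` (Xs i1 @^-1` D `&` tail_event B)) =
  Q (Xs ord0 @^-1` C) * (Q (Xs i1 @^-1` D) * \prod_(i < n) Q (Xt i @^-1` B i)))%E.
Proof.
move=> mC mD mB.
have := iXs (B := cons_fam C (cons_fam D B)).
rewrite !bigcap_ord_recl !big_ord_recl !cons_famS !cons_fam0.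
under eq_bigcapr do rewrite !cons_famS.
under eq_bigr do rewrite !cons_famS.
apply => i; case: (unliftP ord0 i) => [j|] ->; rewrite ?cons_fam0// cons_famS.
by case: (unliftP ord0 j) => [k|] ->; rewrite ?cons_fam0// cons_famS.
Qed.

Let tailE B : (forall i, measurable (B i)) ->
  Q (tail_event B) = (\prod_(i < n) Q (Xt i @^-1` B i))%E.
Proof.
move=> mB; have := indep3 measurableT measurableT mB.
by rewrite !preimage_setT !setTI !probability_setT !mul1e.
Qed.

Variable f : R * R -> R.
Hypothesis mf : measurable_fun setT f.

Lemma merge_joint_law : exists m1 m2 : probability (measurableTypeR R) R,
  [/\ forall C, m1 C = Q (Xs ord0 @^-1` C), forall C, m2 C = Q (Xs i1 @^-1` C) &
  forall B A, (forall i, measurable (B i)) -> measurable A ->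
   (Q ((fun w => (Xs ord0 w, Xs i1 w)) @^-1` A `&` tail_event B) =
   (m1 \x m2) A * Q (tail_event B))%E].
Proof.
pose M := measurableTypeR R.
have mXM i : measurable_fun setT (Xs i : T -> M) by exact: mXs.
pose U : {mfun T >-> M} :=
  HB.pack (Xs ord0 : T -> M) (isMeasurableFun.Build _ _ _ _ (Xs ord0 : T -> M) (mXM _)).
pose V : {mfun T >-> M} :=
  HB.pack (Xs i1 : T -> M) (isMeasurableFun.Build _ _ _ _ (Xs i1 : T -> M) (mXM _)).
exists (distribution Q U), (distribution Q V); split => // B A mB mA.
apply: (@joint_lawI _ _ _ Q U V) => //; first exact: mtail.
by move=> C D mC mD; rewrite tailE//; exact: indep3.
Qed.

Lemma merge_independent :
  mutually_independent Q (cons_fam (fun w => f (Xs ord0 w, Xs i1 w)) Xt).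
Proof.
have [m1 [m2 [_ _ H]]] := merge_joint_law.
move=> B mB; rewrite bigcap_ord_recl big_ord_recl !cons_fam0.
under eq_bigcapr do rewrite !cons_famS.
under eq_bigr do rewrite !cons_famS.
have mfB : measurable (f @^-1` B ord0) by rewrite -[X in measurable X]setTI; exact: mf.
rewrite -(@tailE (fun i => B (lift ord0 i)))//.
rewrite -[LHS]/(Q ((fun w => (Xs ord0 w, Xs i1 w)) @^-1` (f @^-1` B ord0) `&` tail_event _)).
rewrite H//; congr *%E.
have := H (fun=> setT) (f @^-1` B ord0) (fun=> measurableT) mfB.
have -> : tail_event (fun=> setT) = setT by apply/seteqP; split.
by rewrite setIT probability_setT mule1 => ->.
Qed.

End merge.

(** * Induction on the number of variables *)

Section dominated.
Context (R : realType) (mu : probability (measurableTypeR R) R) (phi : R -> R).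
Hypothesis mu_cdf : forall x : R, mu [set y : R | y <= x] = (cauchy_cdf x)%:E.
Hypothesis cvx : convex_function (setT : set (convex_lmodType R^o))
    (phi : convex_lmodType R^o -> R^o).

Lemma merge_dominated d (T : measurableType d) (Q : probability T R) (n : nat)
    (Xs : 'I_n.+2 -> T -> R) (p q t : R) :
  (forall i, measurable_fun setT (Xs i)) -> mutually_independent Q Xs ->
  (forall i s, (distfun Q (Xs i) s <= mu [set x : R | (phi x <= s)%R])%E) ->
  0 <= p -> 0 <= q -> p + q = 1 ->
  (distfun Q (fun w => p * Xs ord0 w + q * Xs (lift ord0 ord0) w)%R t <=
   mu [set x : R | (phi x <= t)%R])%E.
Proof.
move=> mXs iXs dXs.
(* A zero weight leaves a single variable, which is dominated by assumption; the two-variable bound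
   concerns positive weights. *)
rewrite le_eqVlt => /predU1P[<- _|p0].
  rewrite add0r => ->.
  by under eq_fun do rewrite mul0r add0r mul1r; exact: dXs.
rewrite le_eqVlt => /predU1P[<-|q0 pq].
  rewrite addr0 => ->.
  by under eq_fun do rewrite mul0r addr0 mul1r; exact: dXs.
have [m1 [m2 [m1E m2E H]]] := merge_joint_law mXs iXs.
pose A := [set z : R * R | p * z.1 + q * z.2 <= t].
have mA : measurable A.
  rewrite -[X in measurable X]setTI.
  apply: (@measurable_fun_le _ _ _ setT (fun z : R * R => p * z.1 + q * z.2) (cst t)) => //.
  by apply: measurable_funD; apply: measurable_funM.
have := H (fun=> setT) A (fun=> measurableT) mA.
rewrite (_ : \bigcap_(i in _) _ = setT); last by apply/seteqP; split.
rewrite setIT probability_setT mule1 => E.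
rewrite -[leLHS]/(Q ((fun w => (Xs ord0 w, Xs (lift ord0 ord0) w)) @^-1` A)) E.
apply: (convex_combination_dominated mu_cdf cvx) => // s.
  by rewrite m1E; exact: dXs.
by rewrite m2E; exact: dXs.
Qed.

(** The hypothesis is an inequality of distribution functions, without equality of laws, because the
    merged variable generally has a different law from the others; the inequality survives merging
    and the induction closes. *)
Lemma convex_sum_dominated d (T : measurableType d) (Q : probability T R) (n : nat)
    (theta : 'I_n.+1 -> R) (Xs : 'I_n.+1 -> T -> R) (t : R) :
  (forall i, 0 <= theta i) -> \sum_(i < n.+1) theta i = 1 ->
  (forall i, measurable_fun setT (Xs i)) -> mutually_independent Q Xs ->
  (forall i s, (distfun Q (Xs i) s <= mu [set x : R | (phi x <= s)%R])%E) ->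
  (distfun Q (fun w => (\sum_(i < n.+1) theta i * Xs i w)%R) t <=
   mu [set x : R | (phi x <= t)%R])%E.
Proof.
elim: n theta Xs => [|n IH] theta Xs th0 th1 mXs iXs dXs.
  move: th1; rewrite big_ord1 => th1.
  by under eq_fun do rewrite big_ord1 th1 mul1r; exact: dXs.
pose i1 : 'I_n.+2 := lift ord0 ord0.
pose r := theta ord0 + theta i1.
have r0 : 0 <= r by rewrite addr_ge0.
(* Normalised weights of the first two variables. If [r = 0] both original weights vanish, and the
   pair [1, 0] serves. *)
have [p [q [p0 q0 pq pr qr]]] : exists p q, [/\ 0 <= p, 0 <= q, p + q = 1,
    r * p = theta ord0 & r * q = theta i1].
  have [rE|rE] := eqVneq r 0.
    exists 1, 0; rewrite rE !mul0r addr0; split => //; apply/esym.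
      by apply/eqP; rewrite eq_le th0 andbT -rE lerDl.
    by apply/eqP; rewrite eq_le th0 andbT -rE lerDr.
  exists (theta ord0 / r), (theta i1 / r); split; rewrite ?divr_ge0//.
  - by rewrite -mulrDl divff.
  - by rewrite mulrC divfK.
  - by rewrite mulrC divfK.
pose f (z : R * R) := p * z.1 + q * z.2.
have mf : measurable_fun setT f by apply: measurable_funD; apply: measurable_funM.
pose Z w := f (Xs ord0 w, Xs i1 w).
pose Xt (i : 'I_n) := Xs (lift ord0 (lift ord0 i)).
have := IH (cons_fam r (fun i => theta (lift ord0 (lift ord0 i)))) (cons_fam Z Xt).
rewrite (_ : (fun w => \sum_(i < n.+1) _) =
    (fun w => \sum_(i < n.+2) theta i * Xs i w)); last first.
  apply/funext => w; rewrite [LHS]big_ord_recl !cons_fam0.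
  under eq_bigr do rewrite !cons_famS.
  rewrite [RHS]big_ord_recl [in RHS]big_ord_recl addrA; congr (_ + _).
  by rewrite /Z /f /= mulrDr !mulrA pr qr.
apply.
- by move=> i; case: (unliftP ord0 i) => [j|] ->; rewrite ?cons_fam0 ?cons_famS.
- rewrite big_ord_recl cons_fam0; under eq_bigr do rewrite cons_famS.
  by rewrite -addrA -th1 [RHS]big_ord_recl [in RHS]big_ord_recl.
- move=> i; case: (unliftP ord0 i) => [j|] ->; rewrite ?cons_fam0 ?cons_famS; first exact: mXs.
  by apply: (measurableT_comp mf); exact: measurable_fun_pair.
- exact: (merge_independent mXs iXs mf).
- move=> i s; case: (unliftP ord0 i) => [j|] ->; rewrite ?cons_fam0 ?cons_famS; first exact: dXs.
  exact: merge_dominated.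
Qed.

End dominated.

Theorem theorem6 (R : realType) (d : measure_display) (Omega : measurableType d)
  (P : probability Omega R) (X : Omega -> R) (phi : R -> R) :
  measurable_fun setT X ->
  (forall x : R, distfun P X x = (atan x / pi + 2^-1)%:E) ->
  convex_function (setT : set (convex_lmodType R^o)) (phi : convex_lmodType R^o -> R^o) ->
  in_Dminus P (phi \o X).
Proof.
move=> mX X_cdf cvx n theta th0 th1 d' T Q Xs mXs iXs eXs t.
pose M := measurableTypeR R.
have mXM : measurable_fun setT (X : Omega -> M) by exact: mX.
pose U : {mfun Omega >-> M} :=
  HB.pack (X : Omega -> M) (isMeasurableFun.Build _ _ _ _ (X : Omega -> M) mXM).
(* With [mu] the law of [X], each [Xs i] satisfies the domination hypothesis with equality. *)
rewrite eXs; apply: (convex_sum_dominated (mu := distribution P U)) => //.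
by move=> i s; rewrite eXs.
Qed.
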